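(* The signed measures $\zeta_n:=\frac{1}{4\cdot 3^n}\Delta\log|Z_n|$ on the Riemann sphere $\hat{\mathbb{C}}$ converge, in the norm of total variation, as $n\to\infty$, to $$\zeta_\infty:=-\frac14\delta(0)-\frac34\delta(\infty)+\sum_{j=0}^{\infty}\frac{1}{4\cdot 3^{j+1}}\left(\sum_{\omega\in q^{-1}\circ f^{-j}(-1)}\delta(\omega)\right),$$ where $q(y):=y^4$ and $f(x):=\frac{x^2-x+4}{x+3}$.
   Context: Sierpinski gasket graphs: $\mathcal{G}_0$ is a triangle (three vertices, three edges), whose three vertices are its external corners. For $n\ge 1$, $\mathcal{G}_n$ is obtained from three copies of $\mathcal{G}_{n-1}$ by joining them at their external corners: for each pair of copies, one external corner of one copy is identified with one external corner of the other, the three identifications using six distinct corners; the three remaining unidentified corners are the external corners of $\mathcal{G}_n$. Ising model: for a finite graph with vertex set $\mathcal{V}$ and edge set $\mathcal{E}$, a spin configuration is a map $\sigma:\mathcal{V}\to\{\pm1\}$; its Hamiltonian is $H(\sigma)=-J\sum_{\langle v,w\rangle\in\mathcal{E}}\sigma(v)\sigma(w)$ with $J>0$ constant (each edge counted once); its Gibbs weight is $W(\sigma)=e^{-H(\sigma)/T}$ with $T>0$. Put $y=e^{J/T}$. The partition function $Z_n$ is the sum of $W(\sigma)$ over all spin configurations on $\mathcal{G}_n$; equivalently $Z_n(y)=\sum_{\sigma}y^{\sum_{\langle v,w\rangle}\sigma(v)\sigma(w)}$, a Laurent polynomial in $y$ (e.g. $Z_0(y)=2y^3+6y^{-1}$),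 regarded as a rational map on $\hat{\mathbb{C}}$. $\delta(\omega)$ is the unit point mass at $\omega\in\hat{\mathbb{C}}$. The Laplacian $\Delta$ is normalized so that, for a nonzero rational function $R$, $\Delta\log|R|$ is the signed measure on $\hat{\mathbb{C}}$ equal to the sum of the unit masses at the zeros of $R$ minus the sum of the unit masses at the poles of $R$, both counted with multiplicity (including zeros and poles at $\infty$); for example $\Delta\log|y-a|=\delta(a)-\delta(\infty)$. $f^{-j}(-1)$ denotes the set of points $x$ with $f^{\circ j}(x)=-1$ (with $f^{0}=\mathrm{id}$), and $q^{-1}\circ f^{-j}(-1)$ the set of $y$ with $q(y)\in f^{-j}(-1)$. *)

(* Defs.v *)
From HB Require Import structures.
From mathcomp Require Import all_boot all_order all_algebra.
From mathcomp Require Import generic_quotient fraction complex.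
From mathcomp Require Import all_classical all_reals all_analysis.
From mathcomp Require Import ring lra zify.

Set Implicit Arguments.
Unset Strict Implicit.
Unset Printing Implicit Defensive.

Import Order.TTheory GRing.Theory Num.Theory.
Import numFieldNormedType.Exports.

Local Open Scope quotient_scope.
Local Open Scope ring_scope.

(* Edges are unordered: each is the two-element set of its endpoints. *)
Record cornered_graph := CorneredGraph {
  vert : finType;
  edges : {set {set vert}};
  corner : 'I_3 -> vert;
  corner_inj : injective corner }.

Definition triangle : cornered_graph :=
  @CorneredGraph 'I_3 [set e : {set 'I_3} | #|e| == 2]%SET id (@inj_id _).

Section glue.
Variable G : cornered_graph.

(* In three copies of [G], indexed by 'I_3, corner [j] of copy [i] is identified
   with corner [i] of copy [j] whenever [i != j]; corner [i] of copy [i] stays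
   free.  Since (G, corners) has all permutations of its corners as
   automorphisms when [G] is a gasket, any other choice of which corners to
   identify gives an isomorphic graph. *)
Definition glued (p q : 'I_3 * vert G) : bool :=
  (p == q) || [&& p.1 != q.1, p.2 == corner G q.1 & q.2 == corner G p.1].

Lemma glued_refl : reflexive glued.
Proof. by move=> p; rewrite /glued eqxx. Qed.

Lemma glued_sym : symmetric glued.
Proof.
move=> p q; rewrite /glued eq_sym [q.1 == _]eq_sym.
by congr (_ || (_ && _)); rewrite andbC.
Qed.

Lemma glued_trans : transitive glued.
Proof.
move=> q p r /orP[/eqP->//|/and3P[pq /eqP p2 /eqP q2]].
move=> /orP[/eqP<-|/and3P[qr /eqP q2' /eqP r2]].
  by rewrite /glued pq p2 q2 !eqxx orbT.
have pr1 : p.1 = r.1 by apply: (@corner_inj G); rewrite -q2 -q2'.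
rewrite /glued; apply/orP; left.
by case: p r pr1 p2 r2 {pq q2 qr q2'} => [i v] [k w] /= -> -> ->.
Qed.

Canonical glued_equiv := EquivRel glued glued_refl glued_sym glued_trans.

Definition glue_vert := {eq_quot glued}.
HB.instance Definition _ := [Finite of glue_vert by <:%/].

Definition glue_inj (i : 'I_3) (v : vert G) : glue_vert := \pi_glue_vert (i, v).

Definition glue_edges : {set {set glue_vert}} :=
  \bigcup_(i < 3) [set [set glue_inj i v | v in e] | e : {set vert G} in edges G]%SET.

Definition glue_corner (i : 'I_3) : glue_vert := glue_inj i (corner G i).

Lemma glue_corner_inj : injective glue_corner.
Proof.
move=> i j /eqmodP/= /orP[/eqP[]//|/and3P[ij /eqP/= cij _]].
exact: corner_inj cij.
Qed.

Definition glue : cornered_graph := CorneredGraph glue_edges glue_corner_inj.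

End glue.

Definition gasket (n : nat) : cornered_graph := iter n glue triangle.

(* [false] and [true] stand for the spins 1 and -1. *)
Definition spin (b : bool) : int := (-1) ^+ b.

Section ising.
Variable G : cornered_graph.

Definition spin_config := {ffun vert G -> bool}.

(* An edge being the set of its two endpoints, the product over [v in e] is
   sigma(v) sigma(w) for e = <v, w>. *)
Definition bond_sum (s : spin_config) : int :=
  \sum_(e in edges G) \prod_(v in e) spin (s v).

Definition ising_Z (F : fieldType) (y : F) : F :=
  \sum_(s : spin_config) y ^ (bond_sum s).

Variable R : realType.

Definition hamiltonian (J : R) (s : spin_config) : R := - J * (bond_sum s)%:~R.

Definition gibbs_weight (J T : R) (s : spin_config) : R :=
  expR (- hamiltonian J s / T).

Definition partition_function (J T : R) : R :=
  \sum_(s : spin_config) gibbs_weight J T s.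

Lemma partition_functionE (J T : R) :
  partition_function J T = ising_Z (expR (J / T)).
Proof.
apply: eq_bigr => s _; rewrite /gibbs_weight /hamiltonian.
have -> : - (- J * (bond_sum s)%:~R) / T = J / T * (bond_sum s)%:~R by ring.
case: (bond_sum s) => n.
  by rewrite -pmulrn mulrC expRM_natl.
by rewrite NegzE mulrNz -pmulrn mulrN expRN mulrC expRM_natl.
Qed.

End ising.

Local Open Scope classical_set_scope.

Section point_masses.
Local Open Scope ereal_scope.
Context d (T : measurableType d) (R : realType).
Variables (S : set T) (m : T -> nat).

Definition point_masses (A : set T) : \bar R :=
  \esum_(w in S) ((m w)%:R%:E * dirac w A).

Let term_ge0 w A : 0 <= (m w)%:R%:E * dirac w A :> \bar R.
Proof. by rewrite mule_ge0// lee_fin ler0n. Qed.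

Let point_masses0 : point_masses set0 = 0.
Proof. by apply: esum1 => w _; rewrite measure0 mule0. Qed.

Let point_masses_ge0 A : 0 <= point_masses A.
Proof. exact: esum_ge0. Qed.

Let point_masses_sigma_additive : semi_sigma_additive point_masses.
Proof.
move=> F mF tF mUF.
suff -> : point_masses (\bigcup_n F n) = \sum_(i <oo) point_masses (F i).
  exact: is_cvg_nneseries.
rewrite nneseries_esumT// /point_masses.
transitivity (\esum_(w in S) \esum_(i in [set: nat])
    ((m w)%:R%:E * dirac w (F i) : \bar R)).
  apply: eq_esum => w _.
  rewrite -nneseries_esumT// nneseriesZl//.
  by rewrite (measure_semi_bigcup (dirac w) mF tF mUF).
rewrite !esum_esum//.
rewrite (@reindex_esum _ _ _ (S `*`` fun=> [set: nat]) ([set: nat] `*`` fun=> S)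
  (fun k => (k.2, k.1)))//.
split=> [[w i] [/= Sw _]//|[w i] [v j] _ _ [-> ->]//|[i w] [_ Sw]].
by exists (w, i).
Qed.

HB.instance Definition _ := isMeasure.Build _ _ _ point_masses
  point_masses0 point_masses_ge0 point_masses_sigma_additive.

Lemma point_masses_finite : finite_set S -> fin_num_fun point_masses.
Proof.
move=> finS A mA; rewrite ge0_fin_numE//.
rewrite /point_masses esum_fset// fsbig_finite//= ltey.
apply/negP => /eqP; apply/eqP; rewrite -ltey; apply: lte_sum_pinfty => w _.
by rewrite diracE -EFinM ltry.
Qed.

Lemma point_masses_le_size (s : seq T) :
  S `<=` [set` s] -> (forall w, m w = 1%N) -> point_masses [set: T] <= (size s)%:R%:E.
Proof.
move=> Ss m1.
have fS : finite_set S by apply: sub_finite_set Ss _; exact: finite_seq.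
rewrite /point_masses esum_fset// fsbig_finite//=.
under eq_bigr do rewrite m1 mul1e diracT.
rewrite sumEFin lee_fin big_const_seq count_predT iter_addr addr0.
rewrite ler_nat; apply: uniq_leq_size => [|w]; first exact: finmap.fset_uniq.
by rewrite in_fset_set// inE => /Ss.
Qed.

End point_masses.
Arguments point_masses {d T R}.

Section tv_norm.
Local Open Scope ereal_scope.
Context d (T : measurableType d) (R : realType).
Variable nu : {charge set T -> \bar R}.

(* The choice of Hahn decomposition is irrelevant, by [tv_normE]. *)
Definition tv_norm : \bar R :=
  let P := cid (Hahn_decomposition nu) in
  let N := cid (svalP P) in
  charge_variation (svalP N) [set: T].

Lemma tv_normE P N (nuPN : hahn_decomposition nu P N) :
  tv_norm = charge_variation nuPN [set: T].
Proof.
rewrite /tv_norm; case: cid => P' hP' /=; case: cid => N' h' /=.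
have [uP uN] := Hahn_decomposition_uniq h' nuPN measurableT.
rewrite /charge_variation/= !jordan_posE !jordan_negE !cjordan_posE !cjordan_negE.
by rewrite /crestr0 /crestr/= mem_set// uP uN.
Qed.

End tv_norm.
Arguments tv_norm {d T R}.

(* The Riemann sphere with its Borel sigma-algebra; the alias [R[i]^o] is what
   carries the topology of the norm. *)
Notation sphere R :=
  (g_sigma_algebraType (@open (one_point_compactification (R[i])^o))).

Notation rat_fun R := {fraction {poly R[i]}}.
Notation "p %:F" := (@FracField.tofrac _ p) : ring_scope.

Section divisor.
Variable R : realType.

Definition pt (a : R[i]) : sphere R := Some a.
Definition pt_infty : sphere R := None.

Definition num (f : rat_fun R) : {poly R[i]} := (frac (repr f)).1.
Definition den (f : rat_fun R) : {poly R[i]} := (frac (repr f)).2.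

(* Order of vanishing at a point, negative at poles.  The fraction [num f / den
   f] need not be reduced; see [order_atE]. *)
Definition order_at (f : rat_fun R) (w : sphere R) : int :=
  match w : option R[i] with
  | Some a => (mup a (num f))%:Z - (mup a (den f))%:Z
  | None => (size (den f))%:Z - (size (num f))%:Z
  end.

Definition zeros (f : rat_fun R) : set (sphere R) :=
  [set w | 0 < order_at f w].
Definition poles (f : rat_fun R) : set (sphere R) :=
  [set w | order_at f w < 0].

Definition multiplicity (f : rat_fun R) (w : sphere R) : nat :=
  `|order_at f w|%N.

Lemma den_neq0 f : den f != 0.
Proof. exact: denom_ratioP. Qed.

Lemma num_denE g : g = (num g)%:F / (den g)%:F.
Proof.
have dF0 : (den g)%:F != 0 by rewrite tofrac_eq0 den_neq0.
apply: (canRL (mulfK dF0)); rewrite -[g in LHS]reprK.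
unlock FracField.tofrac; rewrite -[LHS]FracField.pi_mul; apply/eqmodP.
rewrite /= FracField.equivfE /FracField.mulf.
by rewrite !numden_Ratio ?mulr1 ?oner_eq0 ?denom_ratioP// reprK mulrC.
Qed.

Lemma order_atE (p r : {poly R[i]}) (w : sphere R) : p != 0 -> r != 0 ->
  order_at (p%:F / r%:F) w =
    match w : option R[i] with
    | Some a => (mup a p)%:Z - (mup a r)%:Z
    | None => (size r)%:Z - (size p)%:Z
    end.
Proof.
move=> p0 r0; have rF0 : r%:F != 0 by rewrite tofrac_eq0.
have := divfK rF0 p%:F; move: (p%:F / r%:F) => g gr.
have dF0 : (den g)%:F != 0 by rewrite tofrac_eq0 den_neq0.
have /eqP : num g * r = p * den g.
  apply/eqP; rewrite -tofrac_eq !tofracM.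
  by have := divfK dF0 (num g)%:F; rewrite -num_denE => <-; rewrite mulrAC gr.
have [->|n0 /eqP E] := eqVneq (num g) 0.
  by rewrite mul0r eq_sym mulf_eq0 (negbTE p0) (negbTE (den_neq0 g)).
case: w => [a|] /=.
  have := congr1 (mup a) E; rewrite !mupM ?den_neq0//.
  move: (mup a (den g)) (mup a (num g)) (mup a r) (mup a p) => *; lia.
have /= := congr1 (fun u : {poly R[i]} => size u) E.
rewrite !size_mul ?den_neq0//.
have : (0 < size p)%N by rewrite size_poly_gt0.
have : (0 < size r)%N by rewrite size_poly_gt0.
have : (0 < size (num g))%N by rewrite size_poly_gt0.
have : (0 < size (den g))%N by rewrite size_poly_gt0 den_neq0.
move: (size (den g)) (size (num g)) (size r) (size p) => *; lia.
Qed.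

Lemma finite_roots (p : {poly R[i]}) : finite_set [set a | (0 < mup a p)%N].
Proof.
have [->|p0] := eqVneq p 0.
  apply: (@sub_finite_set _ _ set0) => // a /=.
  rewrite /mup; case: arg_maxnP => //= i _ _.
  by case: i => i /=; rewrite size_poly0; case: i.
have [r pE] := closed_field_poly_normal p.
apply: (@sub_finite_set _ _ [set` r]); last exact: finite_seq.
move=> a /=; rewrite -XsubC_dvd// dvdp_XsubCl pE rootZ ?lead_coef_eq0//.
by rewrite root_prod_XsubC.
Qed.

Lemma finite_order (f : rat_fun R) : finite_set [set w | order_at f w != 0].
Proof.
apply: (@sub_finite_set _ _ ((pt @` ([set a | (0 < mup a (num f))%N] `|`
  [set a | (0 < mup a (den f))%N])) `|` [set pt_infty])).
  move=> [a|] /=; last by right.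
  move=> h; left; exists a => //=; move: h.
  by case: mup => [|k] //=; [|by left]; case: mup => [|k] //=; right.
rewrite finite_setU; split; last exact: finite_set1.
by apply: finite_image; rewrite finite_setU; split; exact: finite_roots.
Qed.

Lemma finite_zeros f : finite_set (zeros f).
Proof. by apply: sub_finite_set (finite_order f) => w /= /lt0r_neq0. Qed.

Lemma finite_poles f : finite_set (poles f).
Proof. by apply: sub_finite_set (finite_order f) => w /= /ltr0_neq0. Qed.

Definition zero_masses f : set (sphere R) -> \bar R :=
  point_masses (zeros f) (multiplicity f).
Definition pole_masses f : set (sphere R) -> \bar R :=
  point_masses (poles f) (multiplicity f).

HB.instance Definition _ f := Measure.on (zero_masses f).
HB.instance Definition _ f := Measure.on (pole_masses f).
HB.instance Definition _ f := Measure_isFinite.Build _ _ _ (zero_masses f)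
  (point_masses_finite R (multiplicity f) (finite_zeros f)).
HB.instance Definition _ f := Measure_isFinite.Build _ _ _ (pole_masses f)
  (point_masses_finite R (multiplicity f) (finite_poles f)).

(* The Laplacian of log |f| (with f nonzero), normalized so that
   log |y - a| has Laplacian delta_a - delta_infty. *)
Definition laplacian_log f : {charge set (sphere R) -> \bar R} :=
  cadd (zero_masses f) (copp (pole_masses f)).

End divisor.

Section zeta.
Variable R : realType.

Definition Z (n : nat) : rat_fun R := ising_Z (gasket n) 'X%:F.

Definition zeta (n : nat) : {charge set (sphere R) -> \bar R} :=
  cscale (4 * 3 ^+ n)^-1 (laplacian_log (Z n)).

Definition q (w : sphere R) : sphere R :=
  match w : option R[i] with Some y => pt (y ^+ 4) | None => pt_infty R end.

(* The numerator takes the value 16 at [-3], which is therefore a pole. *)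
Definition f (w : sphere R) : sphere R :=
  match w : option R[i] with
  | Some x =>
      if x == - 3 then pt_infty R else pt ((x ^+ 2 - x + 4) / (x + 3))
  | None => pt_infty R
  end.

Definition f_preim (j : nat) : set (sphere R) :=
  [set x | iter j f x = pt (- 1)].

Definition f_preim_masses (j : nat) : set (sphere R) -> \bar R :=
  point_masses (q @^-1` f_preim j) (fun=> 1%N).

HB.instance Definition _ j := Measure.on (f_preim_masses j).

Definition zeta_lim_pos : set (sphere R) -> \bar R :=
  mseries (fun j => mscale (4 * 3 ^+ j.+1)^-1%:nng (f_preim_masses j)) 0.

HB.instance Definition _ := Measure.on zeta_lim_pos.

Lemma roots_cover (p : {poly R[i]}) :
  exists2 r : seq R[i], size r = (size p).-1 &
    forall x, p != 0 -> root p x -> x \in r.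
Proof.
have [r pE] := closed_field_poly_normal p.
have [->|p0] := eqVneq p 0; first by exists [::]; rewrite ?size_poly0.
exists r; last by move=> x _; rewrite pE rootZ ?lead_coef_eq0// root_prod_XsubC.
by rewrite pE size_scale ?lead_coef_eq0// size_prod_XsubC.
Qed.

Lemma preimage_cover (h : sphere R -> sphere R) (k : nat) :
  (forall c, exists2 r : seq (sphere R), (size r <= k)%N &
    forall x, h x = pt c -> x \in r) ->
  forall s : seq (sphere R), exists2 r : seq (sphere R),
    (size r <= k * size s)%N &
    forall x c, h x = pt c -> pt c \in s -> x \in r.
Proof.
move=> hk; elim=> [|[c|] s [r rs rP]]; first by exists [::].
- have [r1 r1k r1P] := hk c; exists (r1 ++ r).
    by rewrite size_cat /= mulnS leq_add.
  move=> x c' hx; rewrite inE => /orP[/eqP cc'|c's]; rewrite mem_cat.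
    by rewrite r1P// hx cc'.
  by rewrite (rP x c')// orbT.
- exists r; first by rewrite (leq_trans rs)//= mulnS leq_addl.
  by move=> x c hx; rewrite inE /= => cs; apply: rP hx cs.
Qed.

Lemma f_cover c : exists2 r : seq (sphere R), (size r <= 2)%N &
  forall x, f x = pt c -> x \in r.
Proof.
pose b := 4 - 3 * c; pose p : {poly R[i]} := ('X - (1 + c)%:P) * 'X + b%:P.
have sp : size p = 3%N by rewrite size_MXaddC size_XsubC polyXsubC_eq0.
have [r sr rP] := roots_cover p; exists (map (@pt R) r).
  by rewrite size_map sr sp.
move=> [x|//] /=; case: eqVneq => // x3 [] fx; apply: map_f; apply: rP.
  by rewrite -size_poly_gt0 sp.
have x30 : x + 3 != 0 by rewrite addr_eq0.
have cx : x ^+ 2 - x + 4 - c * (x + 3) = 0 by rewrite -fx divfK// subrr.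
by rewrite rootE /p hornerMXaddC hornerXsubC -cx; apply/eqP; rewrite /b; ring.
Qed.

Lemma q_cover c : exists2 r : seq (sphere R), (size r <= 4)%N &
  forall x, q x = pt c -> x \in r.
Proof.
have [r sr rP] := roots_cover ('X^4 - c%:P); exists (map (@pt R) r).
  by rewrite size_map sr size_XnsubC.
move=> [x|//] /= [] qx; apply: map_f; apply: rP.
  by rewrite -size_poly_gt0 size_XnsubC.
by rewrite rootE !hornerE qx subrr.
Qed.

Lemma iter_f_infty j : iter j f (pt_infty R) = pt_infty R.
Proof. by elim: j => //= j ->. Qed.

Lemma f_preim_cover j : exists2 s : seq (sphere R), (size s <= 2 ^ j)%N &
  f_preim j `<=` [set` s].
Proof.
elim: j => [|j [s sj sP]].
  by exists [:: pt (-1)] => // x; rewrite /f_preim/= => ->; rewrite inE.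
have [r rs rP] := preimage_cover f_cover s; exists r.
  by rewrite expnS (leq_trans rs)// leq_mul2l.
move=> x; rewrite /f_preim /= -iterS iterSr => jx.
case fx : (f x) => [c|]; last by move: jx; rewrite fx iter_f_infty.
by apply: (rP x c) => //; apply: sP; move: jx; rewrite fx.
Qed.

Lemma f_preim_masses_le j :
  (f_preim_masses j [set: sphere R] <= (4 * 2 ^ j)%N%:R%:E)%E.
Proof.
have [s sj sP] := f_preim_cover j.
have [r rs rP] := preimage_cover q_cover s.
apply: (@le_trans _ _ (size r)%:R%:E).
  apply: point_masses_le_size => // x /= qx.
  case E : (q x) => [c|].
    by apply: (rP x c) => //; apply: sP; move: qx; rewrite E.
  by move: qx; rewrite E /f_preim/= iter_f_infty.
by rewrite lee_fin ler_nat (leq_trans rs)// leq_mul2l.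
Qed.

Lemma zeta_lim_pos_finite : fin_num_fun zeta_lim_pos.
Proof.
move=> A mA; rewrite ge0_fin_numE//.
apply: (@le_lt_trans _ _ (zeta_lim_pos setT)); first by rewrite le_measure ?inE.
apply: (@le_lt_trans _ _ 1%:E); last by rewrite ltry.
apply: lime_le; first exact: is_cvg_nneseries.
apply: nearW => n; apply: (@le_trans _ _ (1 - (2 / 3) ^+ n)%:E); last first.
  by rewrite lee_fin gerBl exprn_ge0.
elim: n => [|n IH]; first by rewrite big_geq// expr0 subrr.
rewrite big_nat_recr//=.
have -> : 1 - (2 / 3) ^+ n.+1 = 1 - (2 / 3) ^+ n + (2 / 3) ^+ n / 3 :> R.
  by rewrite exprS; field.
rewrite EFinD leeD// /mscale/=.
apply: (le_trans (lee_wpmul2l _ (f_preim_masses_le n))).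
  by rewrite lee_fin invr_ge0.
rewrite -EFinM lee_fin natrM natrX exprS expr_div_n le_eqVlt; apply/orP; left.
by apply/eqP; field; rewrite expf_neq0.
Qed.

HB.instance Definition _ :=
  Measure_isFinite.Build _ _ _ zeta_lim_pos zeta_lim_pos_finite.

Definition zeta_lim : {charge set (sphere R) -> \bar R} :=
  cadd (cadd (cscale (- (1 / 4)) (charge_of_finite_measure (dirac (pt 0))))
             (cscale (- (3 / 4)) (charge_of_finite_measure (dirac (pt_infty R)))))
       zeta_lim_pos.

Lemma zeta_limE (A : set (sphere R)) : (zeta_lim A =
  (- (1 / 4))%:E * dirac (pt 0%R) A + (- (3 / 4))%:E * dirac (pt_infty R) A +
  \sum_(0 <= j <oo) ((4 * 3 ^+ j.+1)^-1)%:E *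
    \esum_(w in q @^-1` f_preim j) dirac w A)%E.
Proof.
rewrite /zeta_lim /cadd/= /cscale/=; congr (_ + _)%E.
apply: eq_eseriesr => j _; congr (_ * _)%E.
by apply: eq_esum => w _; rewrite mul1e.
Qed.

End zeta.

(* Main.v *)
(* Let A_n and B_n be the partition functions of the n-th gasket with its three
   corner spins equal, respectively not all equal.  Summing over the three spins
   at the identified corners gives
     A_(n+1) = A_n^3 + 3 A_n B_n^2 + 4 B_n^3 = (A_n + B_n)(A_n^2 - A_n B_n + 4 B_n^2),
     B_(n+1) = A_n^2 B_n + 4 A_n B_n^2 + 3 B_n^3 = (A_n + B_n)(A_n + 3 B_n) B_n,
   so A_n / B_n evolves under f from A_0 / B_0 = y^4.  Writing A_n / B_n as the
   reduced fraction P_n / Q_n, the common factors P_k + Q_k accumulate: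
   A_n = H_n P_n / y^(3^n) and B_n = H_n Q_n / y^(3^n) with
   H_n = prod_(k < n) (P_k + Q_k)^(3^(n-1-k)), and Z_n = 2 A_n + 6 B_n.  The zeros
   of P_k + Q_k form q^-1 f^-k(-1), and they are simple because the critical
   points -7 and 1 of f, and q(0) = 0, have orbits in the forward invariant set
   {r real, r < -3 or r >= 0} plus infinity, which avoids -1.  Hence zeta_n
   differs from the limit only by the zeros of P_n + 3 Q_n and by the tail of the
   series, each a positive measure of mass at most (2/3)^n. *)
From HB Require Import structures.
Require Import Defs.
From mathcomp Require Import all_boot all_order all_algebra.
From mathcomp Require Import generic_quotient fraction complex.
From mathcomp Require Import ring lra zify.

Set Implicit Arguments.
Unset Strict Implicit.
Unset Printing Implicit Defensive.

Import Order.TTheory GRing.Theory Num.Theory.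

Local Open Scope ring_scope.

(** * Gluing of Ising partition functions *)

Lemma lift_ord3 :
  (lift ord0 (lift ord0 ord0) = 2%:R :> 'I_3) *
  (lift ord0 ord0 = 1 :> 'I_3) * (ord0 = 0 :> 'I_3).
Proof. by split; [split|]; exact: val_inj. Qed.

Lemma ord3_ind (P : 'I_3 -> Prop) : P 0 -> P 1 -> P 2%:R -> forall i, P i.
Proof.
move=> P0 P1 P2 [[|[|[|//]]] i3].
- by rewrite (_ : Ordinal i3 = 0) //; exact: val_inj.
- by rewrite (_ : Ordinal i3 = 1) //; exact: val_inj.
- by rewrite (_ : Ordinal i3 = 2%:R) //; exact: val_inj.
Qed.

(** Two copies share a single vertex, so an edge with two endpoints lies in only one copy. *)
Definition simple_edges (G : cornered_graph) : Prop :=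
  forall e, e \in edges G -> #|e| = 2%N.

Definition corner_pattern (G : cornered_graph) (s : spin_config G)
  : {ffun 'I_3 -> bool} := [ffun i => s (corner G i)].

Definition corner_Z (G : cornered_graph) (F : fieldType) (y : F)
    (c : {ffun 'I_3 -> bool}) : F :=
  \sum_(s : spin_config G | corner_pattern s == c) y ^ (bond_sum s).

Lemma ising_Z_corner (G : cornered_graph) (F : fieldType) (y : F) :
  ising_Z G y = \sum_c corner_Z G y c.
Proof. by rewrite /ising_Z (partition_big (@corner_pattern G) predT). Qed.

Section glue.
Variable G : cornered_graph.

Lemma glue_inj_inj (i : 'I_3) : injective (@glue_inj G i).
Proof. by move=> v w /eqmodP/= /orP[/eqP[]//|/and3P[]]; rewrite eqxx. Qed.

Lemma glue_inj_eq (i j : 'I_3) (v w : vert G) : i != j ->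
  glue_inj i v = glue_inj j w -> v = corner G j /\ w = corner G i.
Proof.
move=> ij /eqmodP/= /orP[/eqP[/eqP]|/and3P[_ /eqP/= -> /eqP/= ->]//].
by rewrite (negbTE ij).
Qed.

Lemma glue_inj_corner (i j : 'I_3) :
  @glue_inj G i (corner G j) = glue_inj j (corner G i).
Proof.
have [->//|ij] := eqVneq i j.
by apply/eqmodP; rewrite /= /glued /= ij !eqxx orbT.
Qed.

Hypothesis simpleG : simple_edges G.

Lemma simple_glue : simple_edges (glue G).
Proof.
move=> e /bigcupP[i _ /imsetP[e' /simpleG e'2 ->]].
by rewrite card_imset //; exact: glue_inj_inj.
Qed.

Definition copy_config (s : spin_config (glue G)) (i : 'I_3) : spin_config G :=
  [ffun v => s (glue_inj i v)].

Lemma bond_sum_glue (s : spin_config (glue G)) :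
  bond_sum s = \sum_i bond_sum (copy_config s i).
Proof.
rewrite /bond_sum /= /glue_edges.
pose E i := [set [set glue_inj i v | v in e] | e : {set vert G} in edges G]%SET.
have E_disj i j : i != j -> [disjoint E i & E j].
  move=> ij; rewrite -setI_eq0; apply/eqP/setP => e; rewrite !inE.
  apply/negP => /andP[/imsetP[e1 e1E ->] /imsetP[e2 e2E e12]].
  have /eqP := simpleG e1E; case/cards2P => v [w [vw e1vw]].
  have: v = w.
    have inv u : u \in e1 -> u = corner G j.
      move=> ue1; have : glue_inj i u \in [set glue_inj j v0 | v0 in e2]%SET.
        by rewrite -e12 imset_f.
      by case/imsetP => u' _ /(glue_inj_eq ij)[].
    have [ve1 we1] : v \in e1 /\ w \in e1 by rewrite e1vw set21 set22.
    by rewrite [LHS]inv// [RHS]inv.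
  by move/eqP; rewrite (negbTE vw).
rewrite partition_disjoint_bigcup//=; apply: eq_bigr => i _.
rewrite big_imset/=; last by move=> e1 e2 _ _ /(imset_inj (@glue_inj_inj i)).
apply: eq_bigr => e _; rewrite big_imset/=; last by move=> v w _ _ /glue_inj_inj.
by apply: eq_bigr => v _; rewrite ffunE.
Qed.

Definition copy_configs (s : spin_config (glue G)) :
  {ffun 'I_3 -> spin_config G} := [ffun i => copy_config s i].

Definition glue_configs (t : {ffun 'I_3 -> spin_config G}) :
  spin_config (glue G) := [ffun v : glue_vert G => t (repr v).1 (repr v).2].

Definition corner_matrix (t : {ffun 'I_3 -> spin_config G}) :
  {ffun 'I_3 -> {ffun 'I_3 -> bool}} := [ffun i => corner_pattern (t i)].

Lemma copy_configsK : cancel copy_configs glue_configs.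
Proof.
move=> s; apply/ffunP => v; rewrite !ffunE /glue_inj -surjective_pairing.
by rewrite reprK.
Qed.

Definition symmetric_matrix (m : {ffun 'I_3 -> {ffun 'I_3 -> bool}}) :=
  [forall i, forall j, m i j == m j i].

(** [glue_configs] reads the spin of a class at one chosen representative. Nothing is lost exactly
    when the copies agree at identified corners; as corner [j] of copy [i] meets corner [i] of copy
    [j], this is symmetry. *)
Lemma glue_configsK (t : {ffun 'I_3 -> spin_config G}) :
  (copy_configs (glue_configs t) == t) = symmetric_matrix (corner_matrix t).
Proof.
apply/eqP/idP => [<-|/forallP tsym].
  apply/forallP => i; apply/forallP => j.
  by rewrite !ffunE glue_inj_corner.
apply/ffunP => i; apply/ffunP => v; rewrite !ffunE.
case E : (repr (glue_inj i v)) => [j w] /=.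
have : glue_inj j w = glue_inj i v.
  by rewrite -[RHS]reprK E.
have [->/glue_inj_inj->//|ji /(glue_inj_eq ji)[-> ->]] := eqVneq j i.
by have /forallP/(_ j)/eqP := tsym i; rewrite !ffunE.
Qed.

Variables (F : fieldType) (y : F).
Hypothesis y0 : y != 0.

(** The diagonal of the corner matrix holds the free corners, which are those of the glued graph.
    Grouping compatible families by their matrix makes the sum factor over the copies. *)
Lemma corner_Z_glue (c : {ffun 'I_3 -> bool}) :
  corner_Z (glue G) y c =
  \sum_(m | symmetric_matrix m && [forall i, m i i == c i])
    \prod_i corner_Z G y (m i).
Proof.
transitivity (\sum_(t | symmetric_matrix (corner_matrix t) &&
    [forall i, corner_matrix t i i == c i]) \prod_i y ^ bond_sum (t i)).
  rewrite (reindex_onto copy_configs glue_configs)/=; last first.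
    by move=> t /andP[tsym _]; apply/eqP; rewrite glue_configsK.
  apply: eq_big => [s|s _]; last first.
    rewrite bond_sum_glue; elim/big_rec2: _ => [|i u v _ IH]; first by rewrite expr0z.
    by rewrite expfzDr// -IH ffunE.
  have symC : symmetric_matrix (corner_matrix (copy_configs s)).
    by rewrite -glue_configsK copy_configsK.
  rewrite symC copy_configsK eqxx andbT /=.
  apply/eqP/forallP => [<- i|diagC]; first by rewrite !ffunE.
  by apply/ffunP => i; rewrite -(eqP (diagC i)) !ffunE.
rewrite (partition_big corner_matrix
  (fun m => symmetric_matrix m && [forall i, m i i == c i]))//=.
apply: eq_bigr => m Pm.
rewrite /corner_Z (bigA_distr_big_dep (fun i s => corner_pattern s == m i)).
apply: eq_bigl => t; apply/andP/familyP => [[_ /eqP tm] i|tm].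
  by rewrite -tm unfold_in ffunE.
suff -> : corner_matrix t = m by [].
by apply/ffunP => i; rewrite ffunE; apply/eqP; exact: tm.
Qed.

(* Row [i] lists the corner spins of copy [i]; [u] lists the spins at the
   identified corners {0,1}, {0,2}, {1,2}. *)
Let matrix_of (u : bool * bool * bool) (c : {ffun 'I_3 -> bool}) :=
  [ffun i : 'I_3 => [ffun j : 'I_3 =>
    if i == j then c i else if i + j == 1 then u.1.1
    else if i + j == 2 then u.1.2 else u.2]%N].

(** The three off-diagonal spins are summed over. When the corner spins are equal, no opposite inner
    spin gives [A ^+ 3], one makes two rows mixed, and two or three make all rows mixed. *)
Lemma corner_Z_glueE (A B : F) :
  (forall c, corner_Z G y c = if (c 0 == c 1) && (c 0 == c 2%:R) then A else B) ->
  forall c, corner_Z (glue G) y c =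
    if (c 0 == c 1) && (c 0 == c 2%:R)
    then A ^+ 3 + 3 * A * B ^+ 2 + 4 * B ^+ 3
    else A ^+ 2 * B + 4 * A * B ^+ 2 + 3 * B ^+ 3.
Proof.
move=> AB c; rewrite corner_Z_glue.
under eq_bigr do rewrite !big_ord_recl big_ord0 !AB.
rewrite (reindex_onto (matrix_of^~ c) (fun m => (m 0 1, m 0 2%:R, m 1 2%:R)))/=.
  rewrite (eq_bigl predT); last first.
    move=> [[u v] w] /=; rewrite !ffunE /= eqxx andbT.
    apply/andP; split; apply/forallP => i; last by rewrite !ffunE eqxx.
    apply/forallP => j; rewrite !ffunE [j == i]eq_sym [(j + i)%N]addnC.
    by have [->|_] := eqVneq i j; rewrite eqxx.
  set W := BIG_F.
  rewrite [LHS](_ : _ = \sum_u \sum_v \sum_w W (u, v, w)); last first.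
    rewrite pair_bigA pair_bigA /=.
    by apply: eq_bigr => -[[u v] w].
  rewrite {}/W !big_bool /= !ffunE /= !lift_ord3.
  by case: (c 0) (c 1) (c 2%:R) => -[] [] /=; ring.
move=> m /andP[/forallP msym /forallP diag]; apply/ffunP => i; apply/ffunP => j.
rewrite !ffunE; have := msym i => /forallP/(_ j)/eqP; have := diag i => /eqP <-.
by elim/ord3_ind: i; elim/ord3_ind: j.
Qed.
End glue.

Lemma corner_Z_triangle (F : fieldType) (y : F) (c : {ffun 'I_3 -> bool}) : y != 0 ->
  corner_Z triangle y c = if (c 0 == c 1) && (c 0 == c 2%:R) then y ^+ 3 else y^-1.
Proof.
move=> y0; rewrite /corner_Z (big_pred1 c); last first.
  by move=> s /=; congr (_ == _); apply/ffunP => i; rewrite ffunE.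
suff -> : bond_sum (G := triangle) c =
    if (c 0 == c 1) && (c 0 == c 2%:R) then 3 else -1.
  by case: ifP.
rewrite /bond_sum.
transitivity (\sum_(i : 'I_3) \prod_(v in ~: [set i]) spin (c v)).
  have -> : edges triangle = [set ~: [set i] | i : 'I_3].
    apply/setP => e; rewrite inE; apply/eqP/imsetP => [e2|[i _ ->]].
      have /eqP/cards1P[i ei] : #|~: e| = 1%N.
        by have := cardsC e; rewrite e2 card_ord => -[].
      by exists i => //; rewrite -ei setCK.
    by rewrite cardsC1 card_ord.
  by rewrite big_imset//= => i j _ _ /setC_inj/set1_inj.
under eq_bigr do rewrite big_mkcond !big_ord_recl big_ord0 /= !inE.
rewrite !big_ord_recl big_ord0 /= !lift_ord3.
by case: (c 0) (c 1) (c 2%:R) => -[] [].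
Qed.

Lemma ising_Z_cornerE (G : cornered_graph) (F : fieldType) (y A B : F) :
  (forall c, corner_Z G y c = if (c 0 == c 1) && (c 0 == c 2%:R) then A else B) ->
  ising_Z G y = 2 * A + 6 * B.
Proof.
move=> AB; rewrite ising_Z_corner; under eq_bigr do rewrite AB.
pose pattern (u : bool * bool * bool) :=
  [ffun i : 'I_3 => if i == 0 then u.1.1 else if i == 1 then u.1.2 else u.2].
rewrite (reindex_onto pattern (fun c => (c 0, c 1, c 2%:R)))/=; last first.
  by move=> c _; apply/ffunP => i; rewrite ffunE; elim/ord3_ind: i.
rewrite (eq_bigl predT); last by move=> [[u v] w]; rewrite !ffunE /= eqxx.
set W := BIG_F.
rewrite [LHS](_ : _ = \sum_u \sum_v \sum_w W (u, v, w)); last first.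
  by rewrite pair_bigA pair_bigA /=; apply: eq_bigr => -[[u v] w].
rewrite {}/W !big_bool /= !ffunE /=; ring.
Qed.

(** Both recursions contain the factor [p + q], which joins [h ^+ 3] in the next prefactor. *)
Lemma glue_fraction_eq (F : fieldType) (h p q x : F) : x != 0 ->
  (h * p / x) ^+ 3 + 3 * (h * p / x) * (h * q / x) ^+ 2 + 4 * (h * q / x) ^+ 3 =
  h ^+ 3 * (p + q) * (p ^+ 2 - p * q + 4 * q ^+ 2) / x ^+ 3.
Proof. by move=> x0; field. Qed.

Lemma glue_fraction_neq (F : fieldType) (h p q x : F) : x != 0 ->
  (h * p / x) ^+ 2 * (h * q / x) + 4 * (h * p / x) * (h * q / x) ^+ 2 +
    3 * (h * q / x) ^+ 3 =
  h ^+ 3 * (p + q) * (q * (p + 3 * q)) / x ^+ 3.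
Proof. by move=> x0; field. Qed.

(** * The renormalization map and its critical orbits *)

(* Not imported earlier: [set0] and [[disjoint A & B]] would be shadowed by their
   classical counterparts. *)
From mathcomp Require Import all_classical all_reals all_analysis.
From mathcomp Require Import ring lra zify.
Import numFieldNormedType.Exports.
Local Open Scope ring_scope.

(* The map [f] in homogeneous coordinates. *)
Definition renorm (K : comNzRingType) (u : K * K) : K * K :=
  (u.1 ^+ 2 - u.1 * u.2 + 4 * u.2 ^+ 2, u.2 * (u.1 + 3 * u.2)).

(** Where the second component vanishes, the first is [p ^+ 2] (at [q = 0]) or [16 * q ^+ 2] (at
    [p = - 3 * q]), so no common zero arises along an orbit. *)
Lemma renorm_eq0 (K : numFieldType) (u : K * K) : renorm u = (0, 0) -> u = (0, 0).
Proof.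
case: u => [p q] [/= E1 /eqP]; rewrite mulf_eq0 => /orP[/eqP q0|/eqP pq].
  move: E1; rewrite q0 mulr0 subr0 expr0n mulr0 addr0 => /eqP.
  by rewrite sqrf_eq0 => /eqP ->.
have p3 : p = - 3 * q by apply/eqP; rewrite mulNr -addr_eq0 pq.
have : 16 * q ^+ 2 = 0 by rewrite -E1 p3; ring.
by move/eqP; rewrite mulf_eq0 pnatr_eq0/= sqrf_eq0 => /eqP q0; rewrite p3 q0 mulr0.
Qed.

Lemma iter_renorm_neq0 (K : numFieldType) (x : K) n :
  iter n (@renorm K) (x, 1) != (0, 0).
Proof.
elim: n => [|n IH]; first by rewrite xpair_eqE oner_eq0 andbF.
by apply: contra IH => /eqP/renorm_eq0/eqP.
Qed.

(** * Polynomial form of the partition functions *)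

Section gasket_poly.
Variable K : numFieldType.

Definition gasket_pq n : {poly K} * {poly K} := iter n (@renorm _) ('X^4, 1).
Definition polyP n := (gasket_pq n).1.
Definition polyQ n := (gasket_pq n).2.
Definition polyT n := polyP n + polyQ n.
(** This factor occurs twice: in [polyQ n.+1], and in the partition function because
    [2 A + 6 B = 2 (A + 3 B)]. *)
Definition polyS n := polyP n + 3 * polyQ n.

Fixpoint polyH n : {poly K} :=
  if n is n'.+1 then polyH n' ^+ 3 * polyT n' else 1.

Lemma polyPS n :
  polyP n.+1 = polyP n ^+ 2 - polyP n * polyQ n + 4 * polyQ n ^+ 2.
Proof. by []. Qed.

Lemma polyQS n : polyQ n.+1 = polyQ n * polyS n.
Proof. by []. Qed.

Lemma polyHS n : polyH n.+1 = polyH n ^+ 3 * polyT n.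
Proof. by []. Qed.

Lemma horner_gasket_pq n a :
  ((polyP n).[a], (polyQ n).[a]) = iter n (@renorm K) (a ^+ 4, 1).
Proof.
elim: n => [|n IH]; first by rewrite /= !hornerE.
by rewrite [RHS]iterS -IH /renorm /= polyPS polyQS /polyS -!polyC_natr !hornerE.
Qed.

Lemma corner_Z_gasket n (c : {ffun 'I_3 -> bool}) :
  corner_Z (gasket n) ('X%:F : {fraction {poly K}}) c =
  if (c 0 == c 1) && (c 0 == c 2%:R)
  then (polyH n * polyP n)%:F / ('X^(3 ^ n))%:F
  else (polyH n * polyQ n)%:F / ('X^(3 ^ n))%:F.
Proof.
have X0 : 'X%:F != 0 :> {fraction {poly K}} by rewrite tofrac_eq0 polyX_eq0.
(* [corner_Z_glueE] requires simple edges, so they are carried through the induction. *)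
suff [_] : simple_edges (gasket n) /\ forall c, corner_Z (gasket n)
  ('X%:F : {fraction {poly K}}) c =
  if (c 0 == c 1) && (c 0 == c 2%:R)
  then (polyH n * polyP n)%:F / ('X^(3 ^ n))%:F
  else (polyH n * polyQ n)%:F / ('X^(3 ^ n))%:F by apply.
elim: n => [|n [simp IH]] {c}.
  split; first by move=> e; rewrite inE => /eqP.
  move=> c; rewrite corner_Z_triangle // /polyP /polyQ /= expn0 expr1 !mul1r.
  case: ifP => _; last by [].
  by rewrite tofracXn [_ ^+ 4]exprSr mulfK.
split; first exact: simple_glue.
move=> c; rewrite (corner_Z_glueE simp X0 IH).
have Xn0 : 'X%:F ^+ (3 ^ n) != 0 :> {fraction {poly K}} by rewrite expf_neq0.
have -> : 'X^(3 ^ n.+1) = 'X^(3 ^ n) ^+ 3 :> {poly K} by rewrite -exprM expnSr.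
rewrite polyHS polyPS polyQS /polyS /polyT.
case: ifP => _; rewrite !(tofracXn, tofracMn, tofrac1, tofracM, tofracN, tofracD).
  exact: glue_fraction_eq.
exact: glue_fraction_neq.
Qed.

Lemma ising_Z_gasket n :
  ising_Z (gasket n) ('X%:F : {fraction {poly K}}) =
  (2 *: (polyH n * polyS n))%:F / ('X^(3 ^ n))%:F.
Proof.
rewrite (ising_Z_cornerE (corner_Z_gasket n)) !mulrA -mulrDl; congr (_ / _).
rewrite scaler_nat -mulr_natl /polyS.
rewrite !(tofracMn, tofrac1, tofracM, tofracD).
by move: (polyH n)%:F (polyP n)%:F (polyQ n)%:F => h p q; ring.
Qed.

Lemma monic_sizeDl (p q : {poly K}) : p \is monic -> (size q < size p)%N ->
  (p + q \is monic) /\ size (p + q) = size p.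
Proof.
move=> /monicP p1 qp; split; last by rewrite size_polyDl.
by apply/monicP; rewrite lead_coefDl.
Qed.

(** The strict bound on [polyQ] lets [polyP] dominate in [polyT] and [polyS], which fixes their
    degrees. *)
Lemma gasket_poly_size n :
  [/\ polyP n \is monic, size (polyP n) = (4 * 2 ^ n).+1 &
      (size (polyQ n) < (4 * 2 ^ n).+1)%N].
Proof.
elim: n => [|n [mP sP sQ]].
  by rewrite /polyP /polyQ /= monicXn size_polyXn size_poly1.
set d := (4 * 2 ^ n)%N in sP sQ.
have -> : (4 * 2 ^ n.+1 = d + d)%N by rewrite expnS /d; lia.
have d0 : (0 < d)%N by rewrite muln_gt0 expn_gt0.
have [mPQ sPQ] : (polyP n - polyQ n \is monic) /\ size (polyP n - polyQ n) = d.+1.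
  by rewrite -sP; apply: monic_sizeDl; rewrite // size_polyN sP.
have sPP : size (polyP n * (polyP n - polyQ n)) = (d + d).+1.
  by rewrite size_monicM ?monic_neq0// sP sPQ addSn addnS.
have sS : (size (polyS n) <= d.+1)%N.
  rewrite (leq_trans (size_polyD _ _))// geq_max sP leqnn/= -polyC_natr.
  by rewrite mul_polyC (leq_trans (size_scale_leq _ _))// ltnW.
have -> : polyP n.+1 = polyP n * (polyP n - polyQ n) + 4%:P * polyQ n ^+ 2.
  by rewrite polyPS polyC_natr; ring.
rewrite polyQS.
have sQ2 : (size (4%:P * polyQ n ^+ 2)%R < size (polyP n * (polyP n - polyQ n))%R)%N.
  rewrite sPP mul_polyC (leq_ltn_trans (size_scale_leq _ _))// expr2.
  rewrite (leq_ltn_trans (size_polyMleq _ _))//; lia.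
have [m s] := monic_sizeDl (rpredM mP mPQ) sQ2.
rewrite m s sPP; split => //.
rewrite (leq_ltn_trans (size_polyMleq _ _))//; lia.
Qed.

Lemma polyT_size n : (polyT n \is monic) /\ size (polyT n) = (4 * 2 ^ n).+1.
Proof.
have [mP sP sQ] := gasket_poly_size n; rewrite -sP.
by apply: monic_sizeDl; rewrite ?sP.
Qed.

Lemma polyS_size n : (polyS n \is monic) /\ size (polyS n) = (4 * 2 ^ n).+1.
Proof.
have [mP sP sQ] := gasket_poly_size n; rewrite -sP.
apply: monic_sizeDl; rewrite ?sP// -polyC_natr mul_polyC.
exact: leq_ltn_trans (size_scale_leq _ _) sQ.
Qed.

(* The last two factors are the numerator of [f'], up to the square of the
   denominator: the critical points of [f] are -7 and 1. *)
Lemma wronskian_gasket n :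
  let W m := (polyP m)^`() * polyQ m - polyP m * (polyQ m)^`() in
  W n.+1 = W n * (polyP n + 7 * polyQ n) * (polyP n - polyQ n).
Proof.
rewrite /= polyPS polyQS /polyS.
rewrite !mulr_natl !expr2 !(derivMn, derivD, derivN, derivM).
by move: (polyP n) (polyQ n) (_^`()) (_^`()) => p q p' q'; ring.
Qed.
End gasket_poly.

(** * Simplicity of the zeros of [P + Q] *)

Section simple_roots.
Variable R : realType.
Local Notation C := R[i].

(** Without division, this says that the ratio is real and lies in the given set. Leaving out [-3],
    the pole of [f], keeps the orbits finite; the zero pair qualifies too. *)
Definition exceptional (u : C * C) :=
  exists2 r : R, (r < -3) || (0 <= r) & u.1 = r%:C%C * u.2.

Lemma exceptional_renorm u : exceptional u -> exceptional (renorm u).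
Proof.
case: u => [p q] [r rP /= ->].
have r3 : r + 3 != 0 by apply/eqP; move/orP: rP; lra.
exists ((r ^+ 2 - r + 4) / (r + 3)).
  case/orP: rP => rP.
    (* The inequality amounts to [(r + 1) ^+ 2 + 12 > 0]. *)
    by rewrite ltr_ndivrMr; [|lra]; apply/orP; left; nra.
  by rewrite divr_ge0 ?orbT//; nra.
rewrite /= !(rmorphM, rmorphD, rmorphB, rmorphXn, fmorphV, rmorph_nat) /=.
have : (r%:C + 3)%C != 0 :> C.
  by have := r3; rewrite -(fmorph_eq0 (real_complex R)) rmorphD rmorph_nat.
by move=> ?; field.
Qed.

Lemma exceptional_sum_neq0 (u : C * C) :
  exceptional u -> u != (0, 0) -> u.1 + u.2 != 0.
Proof.
case: u => [p q] [r rP /= ->]; apply: contra.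
have -> : r%:C%C * q + q = (r + 1)%:C%C * q by rewrite rmorphD rmorph1 mulrDl mul1r.
rewrite mulf_eq0 fmorph_eq0 => /orP[/eqP r1|/eqP ->]; last by rewrite mulr0.
by exfalso; move/orP: rP; lra.
Qed.

(** By [wronskian_gasket], a zero comes from an earlier zero, covered by induction and invariance,
    or from a previous ratio [-7] or [1], both in the set. For [n = 0] the Wronskian is [4 X^3], and
    the ratio at [0] is [0]. *)
Lemma wronskian_root_exceptional n (a : C) :
  ((polyP C n)^`() * polyQ C n - polyP C n * (polyQ C n)^`()).[a] = 0 ->
  exceptional ((polyP C n).[a], (polyQ C n).[a]).
Proof.
elim: n => [|n IH].
  have [-> ->] : polyP C 0 = 'X^4 /\ polyQ C 0 = 1%:P by [].
  rewrite derivXn derivC mulr0 subr0 hornerM hornerMn.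
  rewrite !hornerXn hornerC mulr1 => /eqP.
  rewrite mulrn_eq0 /= expf_eq0 /= => /eqP ->.
  by exists 0; rewrite ?lexx ?orbT//= expr0n mul0r.
rewrite wronskian_gasket hornerM hornerM => /eqP.
rewrite horner_gasket_pq iterS -horner_gasket_pq !mulf_eq0 => /orP[/orP[/eqP/IH|]|].
- exact: exceptional_renorm.
- rewrite -polyC_natr !hornerE addr_eq0 => /eqP P7.
  apply: exceptional_renorm; exists (-7); first by apply/orP; left; lra.
  by rewrite /= P7 rmorphN rmorph_nat mulNr.
- rewrite !hornerE subr_eq0 => /eqP PQ.
  apply: exceptional_renorm; exists 1; first by rewrite ler01 orbT.
  by rewrite /= PQ rmorph1 mul1r.
Qed.

(* A double zero of P + Q is a zero of the Wronskian P'Q - PQ'. *)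
Lemma mup_polyT n (a : C) : mup a (polyT C n) = root (polyT C n) a.
Proof.
have [mT _] := polyT_size C n; have T0 := monic_neq0 mT.
case: (boolP (root _ a)) => [ra|]; last exact: mupNroot.
apply/eqP; rewrite eqn_leq; apply/andP; split; last first.
  by rewrite mup_geq// expr1 dvdp_XsubCl.
rewrite leqNgt mup_geq//; apply/negP => /dvdpP[p Tp].
have Ta : (polyP C n).[a] + (polyQ C n).[a] = 0 by rewrite -hornerD; apply/eqP.
have dTa : (polyP C n)^`().[a] + (polyQ C n)^`().[a] = 0.
  rewrite -hornerD -derivD -/(polyT C n) Tp expr2 !derivM !(hornerD, hornerM).
  by rewrite hornerX hornerN hornerC subrr; ring.
suff /exceptional_sum_neq0 : exceptional ((polyP C n).[a], (polyQ C n).[a]).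
  by rewrite {1}horner_gasket_pq iter_renorm_neq0 Ta eqxx => /(_ isT).
apply: wronskian_root_exceptional; rewrite !hornerE.
by rewrite -(addr0_eq Ta) -(addr0_eq dTa); ring.
Qed.

Definition ratio (u : C * C) : sphere R :=
  if u.2 == 0 then pt_infty R else pt (u.1 / u.2).

Lemma f_ratio (u : C * C) : u != (0, 0) -> f (ratio u) = ratio (renorm u).
Proof.
case: u => [x y] u0; rewrite /ratio /=; have [y0|y0] := eqVneq y 0.
  by rewrite y0 mul0r eqxx.
rewrite /= mulf_eq0 (negbTE y0) /=.
have -> : (x / y == - 3) = (x + 3 * y == 0).
  by rewrite -(inj_eq (mulIf y0)) divfK// mulNr addr_eq0.
case: eqVneq => // xy; congr pt; field.
by rewrite y0 xy.
Qed.

Lemma iter_f_ratio n (x : C) : iter n (@f R) (pt x) = ratio (iter n (@renorm C) (x, 1)).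
Proof.
elim: n => [|n IH]; first by rewrite /ratio /= oner_eq0 divr1.
by rewrite !iterS IH f_ratio// iter_renorm_neq0.
Qed.

(** [P] and [Q] have no common zero; where [Q] vanishes, the ratio is infinity and [P + Q] is
    nonzero, so both sides fail. *)
Lemma root_polyT n a : root (polyT C n) a <-> iter n (@f R) (q (pt a)) = pt (-1).
Proof.
rewrite iter_f_ratio -horner_gasket_pq rootE hornerD /ratio /=.
have := iter_renorm_neq0 (a ^+ 4) n; rewrite -horner_gasket_pq xpair_eqE.
set x := _.[a]; set y := _.[a]; have [->|y0] := eqVneq y 0.
  by rewrite andbT addr0 => /negbTE ->; split.
move=> _; split=> [/eqP xy|[/(canRL (divfK y0)) ->]].
  have -> : x = - y by apply/eqP; rewrite -addr_eq0 xy.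
  by rewrite mulNr divff.
by rewrite mulN1r addNr.
Qed.

End simple_roots.

(** * Total variation *)

Local Open Scope classical_set_scope.
Local Open Scope ring_scope.

(** The positive and negative variations are [nu P] and [- nu N] for a Hahn decomposition, each at
    most [c]. *)
Lemma tv_norm_le d (T : measurableType d) (R : realType)
    (nu : {charge set T -> \bar R}) (c : R) :
  (forall A, measurable A -> `|nu A| <= c%:E)%E -> (0 <= tv_norm nu <= (2 * c)%:E)%E.
Proof.
move=> nuc; have [P [N PN]] := Hahn_decomposition nu.
rewrite (tv_normE PN) /charge_variation; apply/andP; split.
  by rewrite adde_ge0// measure_ge0.
have [[mP _] [mN _] _ _] := PN.
rewrite jordan_posE jordan_negE cjordan_posE cjordan_negE /crestr0 /crestr.
rewrite mem_set//= !setTI.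
have -> : 2 * c = c + c by ring.
rewrite EFinD leeD//.
  by rewrite (le_trans _ (nuc _ mP))// lee_abs.
by rewrite (le_trans _ (nuc _ mN))// -abseN lee_abs.
Qed.

Lemma point_masses_seq d (T : measurableType d) (R : realType) (U : seq T)
    (m : T -> nat) (A : set T) : uniq U ->
  point_masses [set` U] m A = (\sum_(w <- U) (m w)%:R * (w \in A)%:R)%:E :> \bar R.
Proof.
move=> uU; rewrite /point_masses esum_fset; last 2 first.
- exact: finite_seq.
- by move=> w _; rewrite mule_ge0// lee_fin ler0n.
rewrite -fsbig_seq// -sumEFin; apply: eq_bigr => w _.
by rewrite diracE -EFinM.
Qed.

Lemma pt_inj (R : realType) : injective (@pt R).
Proof. by move=> a b []. Qed.

(** * Divisors of the partition functions and convergence *)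

Section divisors.
Variable R : realType.
Local Notation C := R[i].

Definition mass (s : seq C) (A : set (sphere R)) : R := \sum_(a <- s) (pt a \in A)%:R.

Lemma mass_cat s t A : mass (s ++ t) A = mass s A + mass t A.
Proof. by rewrite /mass big_cat. Qed.

Lemma mass_bounds s A : 0 <= mass s A <= (size s)%:R.
Proof.
apply/andP; split; first by apply: sumr_ge0 => a _; rewrite ler0n.
rewrite -sum1_size natr_sum; apply: ler_sum => a _.
by case: (_ \in _); rewrite ?ler01.
Qed.

Lemma laplacian_log_seq (g : rat_fun R) (U : seq (sphere R)) A :
  uniq U -> (forall w, order_at g w != 0 -> w \in U) ->
  laplacian_log g A = (\sum_(w <- U) (order_at g w)%:~R * (w \in A)%:R)%:E.
Proof.
move=> uU gU.
have zE : zeros g = [set` [seq w <- U | 0 < order_at g w]].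
  apply/seteqP; split=> w /=; rewrite mem_filter; last by case/andP.
  by rewrite /zeros /= => gw; rewrite gw gU// gt_eqF.
have pE : poles g = [set` [seq w <- U | order_at g w < 0]].
  apply/seteqP; split=> w /=; rewrite mem_filter; last by case/andP.
  by rewrite /poles /= => gw; rewrite gw gU// lt_eqF.
have -> : laplacian_log g A = (zero_masses g A - pole_masses g A)%E by [].
rewrite /zero_masses /pole_masses zE pE.
rewrite !point_masses_seq ?filter_uniq// -EFinB; congr EFin.
rewrite !big_filter [X in X - _]big_mkcond [X in _ - X]big_mkcond/= -sumrB.
apply: eq_bigr => w _.
rewrite /multiplicity; case: ltrgt0P => [g0|g0|->]; last by rewrite mul0r subr0.
  by rewrite subr0 -{2}(gtz0_abs g0).
by rewrite sub0r -mulNr -{2}(opprK (order_at g w)) -(ltz0_abs g0) rmorphN.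
Qed.

Lemma mup_prod_XsubC (s : seq C) a :
  mup a (\prod_(b <- s) ('X - b%:P)) = count_mem a s.
Proof.
elim: s => [|b s IH]; first by rewrite big_nil mupNroot// root1.
rewrite big_cons mupM ?polyXsubC_eq0 ?monic_neq0 ?monic_prod_XsubC//.
by rewrite IH /= -['X - _]expr1 mup_XsubCX; case: eqVneq.
Qed.

Lemma sum_count_mem (U s : seq C) (g : C -> R) : uniq U -> {subset s <= U} ->
  \sum_(a <- U) (count_mem a s)%:R * g a = \sum_(a <- s) g a.
Proof.
move=> uU; elim: s => [|b s IH] sU.
  by rewrite big_nil big1// => a _; rewrite mul0r.
rewrite big_cons -IH; last by move=> a as_; rewrite sU// inE as_ orbT.
rewrite [in RHS](bigD1_seq b)//= ?sU ?mem_head//.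
rewrite (bigD1_seq b)//= ?sU ?mem_head// eqxx natrD mulrDl mul1r -addrA.
congr (_ + (_ + _)); apply: eq_bigr => a ab.
by rewrite eq_sym (negbTE ab).
Qed.

(** Points common to [s] and [t] cancel in the difference of masses; the last term is the order at
    infinity, a difference of degrees. *)
Lemma laplacian_log_prod (s t : seq C) (c d : C) A : c != 0 -> d != 0 ->
  laplacian_log ((c *: \prod_(a <- s) ('X - a%:P))%:F /
                 (d *: \prod_(a <- t) ('X - a%:P))%:F) A =
  (mass s A - mass t A +
   ((size t)%:R - (size s)%:R) * (pt_infty R \in A)%:R)%:E.
Proof.
move=> c0 d0.
have pr0 (u : seq C) : \prod_(a <- u) ('X - a%:P) != 0.
  by rewrite monic_neq0// monic_prod_XsubC.
have mupZ e (u : seq C) a : e != 0 ->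
    mup a (e *: \prod_(b <- u) ('X - b%:P)) = count_mem a u.
  move=> e0; rewrite -mul_polyC mupMr ?mup_prod_XsubC//.
  by rewrite rootC.
set g := _ / _.
have gE w : order_at g w = match w : option C with
    | Some a => (count_mem a s)%:Z - (count_mem a t)%:Z
    | None => (size t)%:Z - (size s)%:Z end.
  rewrite order_atE ?scaler_eq0 ?negb_or ?c0 ?d0 ?pr0//.
  case: w => [a|]; first by rewrite !mupZ.
  by rewrite !size_scale// !size_prod_XsubC; lia.
set U := undup (s ++ t).
have uU : uniq (pt_infty R :: map (@pt R) U).
  rewrite /= (map_inj_uniq (@pt_inj R)) undup_uniq andbT.
  by apply/mapP => -[].
rewrite (laplacian_log_seq _ uU); last first.
  move=> [a|]; rewrite gE; last by rewrite mem_head.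
  move=> ga; rewrite in_cons; apply/orP; right.
  rewrite -/(pt a) map_f// mem_undup mem_cat; apply: contraNT ga.
  by rewrite negb_or -!has_pred1 !has_count -!leqNgt !leqn0 => /andP[/eqP -> /eqP ->].
congr EFin; rewrite big_cons addrC; congr (_ + _); last by rewrite gE rmorphB.
rewrite big_map; under eq_bigr do rewrite gE rmorphB mulrBl.
rewrite sumrB !sum_count_mem ?undup_uniq// => a au.
  by rewrite mem_undup mem_cat au orbT.
by rewrite mem_undup mem_cat au.
Qed.

Definition proots (p : {poly C}) : seq C := sval (closed_field_poly_normal p).

Lemma prootsE p : p \is monic -> p = \prod_(a <- proots p) ('X - a%:P).
Proof.
rewrite /proots; case: closed_field_poly_normal => /= r pE /monicP p1.
by rewrite {1}pE p1 scale1r.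
Qed.

Lemma size_proots p : p \is monic -> size (proots p) = (size p).-1.
Proof. by move=> /prootsE {2}->; rewrite size_prod_XsubC. Qed.

Fixpoint rootsH n : seq C :=
  if n is n'.+1 then rootsH n' ++ rootsH n' ++ rootsH n' ++ proots (polyT C n')
  else [::].

Lemma polyH_roots n : polyH C n = \prod_(a <- rootsH n) ('X - a%:P).
Proof.
elim: n => [|n IH]; first by rewrite big_nil.
rewrite polyHS IH /= !big_cat/= -prootsE; last by have [] := polyT_size C n.
by ring.
Qed.

(** The [4 * 2 ^ n] zeros of [polyS n] fill the gap, so the numerator of [Z R n] has degree
    [4 * 3 ^ n]. With the denominator ['X^(3 ^ n)] this yields the weights [- 1/4] at [0] and
    [- 3/4] at infinity. *)
Lemma size_rootsH n : (size (rootsH n) + 4 * 2 ^ n = 4 * 3 ^ n)%N.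
Proof.
elim: n => [//|n IH]; have [m s] := polyT_size C n.
rewrite /= !size_cat size_proots// s !expnS; lia.
Qed.

(** Tripling [rootsH] matches the factor 3 in the normalization, so each [polyT j] keeps the weight
    it received on entering. *)
Lemma mass_rootsH n A : (4 * 3 ^+ n)^-1 * mass (rootsH n) A =
  \sum_(0 <= j < n) (4 * 3 ^+ j.+1)^-1 * mass (proots (polyT C j)) A.
Proof.
elim: n => [|n IH]; first by rewrite big_geq// /mass big_nil mulr0.
rewrite big_nat_recr//= -IH !mass_cat exprS.
by field; rewrite expf_neq0.
Qed.

Lemma zetaE n A : zeta R n A =
  (- (1 / 4) * (pt 0 \in A)%:R - (3 / 4) * (pt_infty R \in A)%:R +
  \sum_(0 <= j < n) (4 * 3 ^+ j.+1)^-1 * mass (proots (polyT C j)) A +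
  (4 * 3 ^+ n)^-1 * mass (proots (polyS C n)) A)%:E.
Proof.
have [mS sS] := polyS_size C n.
have ZE : Z R n =
    (2 *: \prod_(a <- rootsH n ++ proots (polyS C n)) ('X - a%:P))%:F /
    (1 *: \prod_(a <- nseq (3 ^ n) 0) ('X - a%:P))%:F.
  rewrite scale1r big_nseq iter_mulr_1 subr0 big_cat/= -polyH_roots -prootsE//.
  exact: ising_Z_gasket.
have -> : zeta R n A =
  (((4 * 3 ^+ n)^-1)%:E * laplacian_log (Z R n) A)%E by [].
rewrite ZE laplacian_log_prod ?oner_eq0 ?pnatr_eq0//.
rewrite mass_cat size_cat size_nseq size_proots// sS /= size_rootsH.
rewrite -mass_rootsH -EFinM; congr EFin.
have -> : mass (nseq (3 ^ n) 0) A = 3 ^+ n * (pt 0 \in A)%:R.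
  by rewrite /mass big_nseq iter_addr_0 -natrX mulr_natl.
rewrite natrM natrX; field; by rewrite expf_neq0.
Qed.

Lemma q_preim_f_preim j :
  @q R @^-1` @f_preim R j = [set` map (@pt R) (proots (polyT C j))].
Proof.
have [mT _] := polyT_size C j.
have rE a : (a \in proots (polyT C j)) = root (polyT C j) a.
  by rewrite {2}(prootsE mT) root_prod_XsubC.
apply/seteqP; split=> [[a|]|w] /=.
- by move=> /root_polyT ra; apply/map_f; rewrite rE.
- by rewrite /f_preim /= iter_f_infty.
- by move=> /mapP[a]; rewrite rE => /root_polyT ra ->.
Qed.

(** The limit counts each preimage once while the divisor counts multiplicities; simplicity of the
    roots reconciles the two. *)
Lemma uniq_proots_polyT j : uniq (proots (polyT C j)).
Proof.
have [mT _] := polyT_size C j.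
apply/count_mem_uniq => a; rewrite -mup_prod_XsubC -prootsE// mup_polyT.
by rewrite {1}(prootsE mT) root_prod_XsubC.
Qed.

Lemma size_proots_polyT j : size (proots (polyT C j)) = (4 * 2 ^ j)%N.
Proof. by have [m s] := polyT_size C j; rewrite size_proots// s. Qed.

Lemma zeta_limE_mass A : (zeta_lim R A =
  (- (1 / 4) * (pt 0%R \in A)%:R - (3 / 4) * (pt_infty R \in A)%:R)%:E +
  \sum_(0 <= j <oo) ((4 * 3 ^+ j.+1)^-1 * mass (proots (polyT C j)) A)%:E)%E.
Proof.
rewrite zeta_limE !diracE -!EFinM -EFinD.
congr (_ + _)%E; first by congr EFin; ring.
apply: eq_eseriesr => j _; rewrite EFinM; congr (_ * _)%E.
transitivity (point_masses (@q R @^-1` @f_preim R j) (fun=> 1%N) A : \bar R).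
  by apply: eq_esum => w _; rewrite mul1e.
rewrite q_preim_f_preim point_masses_seq; last first.
  by rewrite (map_inj_uniq (@pt_inj R)) uniq_proots_polyT.
by rewrite big_map; under eq_bigr do rewrite mul1r.
Qed.

Lemma partial_sum_le n N A : (n <= N)%N ->
  \sum_(0 <= j < N) (4 * 3 ^+ j.+1)^-1 * mass (proots (polyT C j)) A <=
  \sum_(0 <= j < n) (4 * 3 ^+ j.+1)^-1 * mass (proots (polyT C j)) A
  + ((2 / 3) ^+ n - (2 / 3) ^+ N).
Proof.
elim: N => [|N IH]; first by rewrite leqn0 => /eqP ->; rewrite subrr addr0.
rewrite leq_eqVlt => /predU1P[->|/IH {}IH]; first by rewrite subrr addr0.
rewrite big_nat_recr//=.
(* The term is at most [4 * 2 ^ N / (4 * 3 ^ N.+1)], which equals this difference, so the bounds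
   telescope. *)
suff : (4 * 3 ^+ N.+1)^-1 * mass (proots (polyT C N)) A <=
    (2 / 3) ^+ N - (2 / 3) ^+ N.+1.
  by move: IH; set x := BIG_F; lra.
have /andP[_] := mass_bounds (proots (polyT C N)) A.
rewrite size_proots_polyT natrM natrX => mle.
apply: (le_trans (ler_wpM2l _ mle)); first by rewrite invr_ge0.
rewrite le_eqVlt; apply/orP; left; apply/eqP.
by rewrite !exprS expr_div_n; field; rewrite expf_neq0.
Qed.

(** The difference is the mass from [polyS n] minus the tail of the series. Both lie between [0] and
    [(2 / 3) ^+ n], hence so does the absolute value of their difference. *)
Lemma zeta_dist n A : (`|zeta R n A - zeta_lim R A| <= ((2 / 3) ^+ n)%:E)%E.
Proof.
rewrite zetaE zeta_limE_mass.
set u := fun j => (4 * 3 ^+ j.+1)^-1 * mass (proots (polyT C j)) A.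
have u0 j : 0 <= u j.
  by rewrite mulr_ge0 ?invr_ge0//; case/andP: (mass_bounds (proots (polyT C j)) A).
have lo : ((\sum_(0 <= j < n) u j)%:E <= \sum_(0 <= j <oo) (u j)%:E)%E.
  by rewrite -sumEFin; apply: nneseries_lim_ge => j _ _; rewrite lee_fin.
have hi : (\sum_(0 <= j <oo) (u j)%:E <=
    (\sum_(0 <= j < n) u j + (2 / 3) ^+ n)%:E)%E.
  apply: lime_le; first by apply: is_cvg_nneseries => j _ _; rewrite lee_fin.
  exists n => // N /= nN; rewrite sumEFin lee_fin.
  apply: (le_trans (partial_sum_le A nN)).
  by rewrite lerD2l gerBl exprn_ge0.
have /andP[S0] := mass_bounds (proots (polyS C n)) A.
have [mS sS] := polyS_size C n; rewrite size_proots// sS /= natrM natrX => S1.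
have {S1} : (4 * 3 ^+ n)^-1 * mass (proots (polyS C n)) A <= (2 / 3) ^+ n.
  apply: (le_trans (ler_wpM2l _ S1)); first by rewrite invr_ge0.
  rewrite le_eqVlt; apply/orP; left; apply/eqP.
  by rewrite expr_div_n; field; rewrite expf_neq0.
have : 0 <= (4 * 3 ^+ n)^-1 * mass (proots (polyS C n)) A.
  by rewrite mulr_ge0// invr_ge0.
move: (_ * mass _ _) => e e0 e1.
(* The bounds [lo] and [hi] exclude infinite sums, leaving real inequalities. *)
move: lo hi; case: (\sum_(0 <= j <oo) _)%E => [x||]//.
rewrite /= !lee_fin ler_norml.
by move: (\sum_(0 <= j < n) _) => y *; apply/andP; split; lra.
Qed.

End divisors.

Theorem theorem1p4 (R : realType) :
  tv_norm (cadd (zeta R n) (copp (zeta_lim R))) @[n --> \oo] --> 0%E.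
Proof.
have b n := tv_norm_le (fun A _ => zeta_dist n A :
  (`|cadd (zeta R n) (copp (zeta_lim R)) A| <= _)%E).
apply: (@squeeze_cvge _ _ _ _ (cst 0%E) _ (fun n => (2 * (2 / 3) ^+ n)%:E)).
- exact: nearW.
- exact: cvg_cst.
- apply: cvg_EFin; first exact: nearW.
  rewrite -[0](mulr0 2); apply: cvgMr; apply: cvg_expr.
  by rewrite ger0_norm//; lra.
Qed.
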